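(* Let $f(n)=b_{d}n^{d}+\cdots+b_{0}$ be a polynomial with integer coefficients such that $b_{d}>0$, $\gcd(b_{d},\ldots,b_{0})=1$, and $f(\mathbb{N})\subseteq\mathbb{N}$. Then there exist positive constants $C$, $c_{1}$, $c_{2}$ depending only on $f$ such that for every real $x\geq 1$, every $s\in\mathbb{N}$ and every $t>0$, \[ \sum_{n\leq x}\Big(\frac{f(n)}{\varphi(f(n))}\Big)^{s}\leq \exp\big(s\log\log(s+2)+Cs\big)\,x \] and \[ \#\Big\{n\leq x:\ \frac{f(n)}{\varphi(f(n))}>t\Big\}\leq c_{1}\exp\big(-\exp(c_{2}t)\big)\,x, \] where $n$ ranges over positive integers.
   Context: $\varphi$ denotes Euler's totient function; $\log$ is the natural logarithm; $\mathbb{N}$ is the set of positive integers. *)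

(* Defs.v *)
From mathcomp Require Import all_boot all_order all_algebra.
From mathcomp Require Import reals.

Set Implicit Arguments.
Unset Strict Implicit.
Unset Printing Implicit Defensive.

Import Order.TTheory GRing.Theory Num.Theory.

Local Open Scope ring_scope.

(* The absolute value only transports [f.[n] : int] to [nat], where [totient]
   lives; it is the identity on the polynomials considered, since those
   satisfy [pos_preserving]. *)
Definition natval (f : {poly int}) (n : nat) : nat := `|f.[n%:Z]|%N.

Definition pos_preserving (f : {poly int}) : Prop :=
  forall n : nat, (0 < n)%N -> 0 < f.[n%:Z].

Definition totient_ratio (R : realType) (f : {poly int}) (n : nat) : R :=
  (natval f n)%:R / (totient (natval f n))%:R.

(* Main.v *)
(* The ratio M / phi(M) is the product of p / (p - 1) over the primes p | M.  For
   n <= N and y maximal with y! <= N, split the primes dividing f(n) as follows.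
   - p <= 2 s: by Mertens' upper bound they contribute O(log s) to the ratio.
   - p > y: there are only O(y) of them, since f(n) << N^d <= (y + 1)^(d (y + 1)),
     so they contribute O(1).
   - 2 s < p <= y: (p / (p - 1))^s <= 1 + 2 s / p by Bernoulli, and the product of
     these primes is at most y! <= N.  Averaging over full periods modulo this
     product, the conditions p | f(n) become independent with probability at most
     d / p, because f is nonzero modulo every prime.  Hence the mean of the s-th
     power is at most prod (1 + 2 s d / p^2) = O(1).
   The tail bound is Markov's inequality with s close to exp (c t). *)
Require Import Defs.
From mathcomp Require Import all_boot all_order all_algebra.
From mathcomp Require Import reals.
From mathcomp Require Import sequences exp.
From mathcomp Require Import ring lra zify.

Set Implicit Arguments.
Unset Strict Implicit.
Unset Printing Implicit Defensive.

Import Order.TTheory GRing.Theory Num.Theory.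

Local Open Scope ring_scope.

(** * Upper bounds of Chebyshev and Mertens type for sums and products over primes *)

Lemma coprime_prime_prod (p : nat) (Q : seq nat) :
  prime p -> all prime Q -> p \notin Q -> coprime p (\prod_(q <- Q) q).
Proof.
move=> p_pr; elim: Q => [|q Q IHQ] /=; first by rewrite big_nil coprimen1.
case/andP=> q_pr Q_pr; rewrite inE negb_or big_cons => /andP[neq_pq pNQ].
by rewrite coprimeMr IHQ // prime_coprime // dvdn_prime2 ?neq_pq.
Qed.

Lemma prod_primes_dvd (Q : seq nat) (n : nat) :
  uniq Q -> all prime Q -> all (dvdn^~ n) Q -> (\prod_(p <- Q) p %| n)%N.
Proof.
elim: Q => [|p Q IHQ] /=; first by rewrite big_nil dvd1n.
case/andP=> pNQ uQ /andP[p_pr Q_pr] /andP[p_n Q_n].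
rewrite big_cons Gauss_dvd; last exact: coprime_prime_prod.
by rewrite p_n IHQ.
Qed.

Lemma prime_dvd_fact_leq (p n : nat) : prime p -> (p %| n`!)%N -> (p <= n)%N.
Proof.
move=> p_pr; elim: n => [|n IHn].
  by rewrite fact0 dvdn1 => /eqP p1; rewrite p1 in p_pr.
rewrite factS Euclid_dvdM // => /orP[|/IHn/leqW //].
exact: dvdn_leq.
Qed.

(** The two middle coefficients of the row are equal and their sum is at most [2 ^ k.*2.+1]. *)
Lemma bin_odd_middle_leq (k : nat) : ('C(k.*2.+1, k) <= 4 ^ k)%N.
Proof.
have ltk : (k < k.*2.+2)%N by lia.
have ltk1 : (k.+1 < k.*2.+2)%N by lia.
have sum2 : ('C(k.*2.+1, k) + 'C(k.*2.+1, k.+1) <= 2 ^ k.*2.+1)%N.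
  rewrite (_ : 2 = 1 + 1)%N // expnDn (bigD1 (Ordinal ltk)) //=.
  rewrite (bigD1 (Ordinal ltk1)) /=; last by rewrite -val_eqE /=; lia.
  by rewrite !exp1n !muln1 addnA leq_addr.
have eq_bin : 'C(k.*2.+1, k.+1) = 'C(k.*2.+1, k).
  by rewrite -[RHS]bin_sub; [congr binomial; lia | lia].
by move: sum2; rewrite eq_bin addnn -mul2n expnS leq_pmul2l // -muln2 mulnC expnM.
Qed.

(** Erdős's induction: for [m = 2k + 1] the primes in [(k + 1, 2k + 1]] divide ['C(2k + 1, k)], and
    the smaller ones are handled at [k + 1]; an even [m > 2] adds no prime. *)
Lemma primorial_leq (m : nat) : (\prod_(0 <= p < m.+1 | prime p) p <= 4 ^ m)%N.
Proof.
elim/ltn_ind: m => -[|[|[|m]]] IHm; try by rewrite unlock.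
have [odd_m | even_m] := boolP (odd m); last first.
  have [k Ek] : {k | m.+3 = k.*2.+1} by exists m./2.+1; lia.
  rewrite (big_cat_nat (n := k.+2)) //=; last by lia.
  have -> : (4 ^ m.+3 = 4 ^ k.+1 * 4 ^ k)%N by rewrite -expnD; congr expn; lia.
  apply: leq_mul; first by apply: IHm; lia.
  apply: leq_trans (bin_odd_middle_leq k); apply: dvdn_leq.
    by rewrite bin_gt0; lia.
  rewrite -big_filter; apply: prod_primes_dvd.
  - exact/filter_uniq/iota_uniq.
  - exact: filter_all.
  apply/allP=> p /=; rewrite mem_filter mem_index_iota Ek => /and3P[p_pr lt_kp lt_p].
  have: (p %| k.*2.+1`!)%N by rewrite dvdn_fact // prime_gt0 //=; lia.
  rewrite -(@bin_fact _ k); last by lia.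
  by rewrite !Euclid_dvdM // => /or3P[] // /(prime_dvd_fact_leq p_pr); lia.
rewrite big_mkcond big_nat_recr //= -big_mkcond /= ifF ?muln1.
  by apply: leq_trans (IHm _ _) _; rewrite ?leq_exp2l.
apply/negP => /even_prime[//|]; lia.
Qed.

Lemma fact_leq_expn (m : nat) : (m`! <= m ^ m)%N.
Proof.
rewrite fact_prod -[X in (_ <= _ ^ X)%N]card_ord -prod_nat_const big_add1 big_mkord.
by apply: leq_prod => i _.
Qed.

(** Integer form of Mertens' first estimate: [m %/ p] is the first term of Legendre's formula for
    the valuation of [m!] at [p], and the extra factor [p] costs one primorial. *)
Lemma prod_primes_expn_divn_leq (m : nat) :
  (\prod_(0 <= p < m.+1 | prime p) p ^ (m %/ p).+1 <= (4 * m) ^ m)%N.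
Proof.
have divn_leq : (\prod_(0 <= p < m.+1 | prime p) p ^ (m %/ p) <= m`!)%N.
  rewrite -[leqRHS](partnT (fact_gt0 m)) /partn.
  rewrite [leqRHS](big_cat_nat (n := m.+1)) //=; last by rewrite ltnS fact_geq.
  rewrite -[leqLHS]muln1; apply: leq_mul; last first.
    rewrite big_nat_cond; apply: prodn_cond_gt0 => p /andP[/andP[lt_mp _] _].
    by rewrite expn_gt0 (leq_trans _ lt_mp).
  rewrite big_mkcond [leqRHS]big_nat_cond big_nat_cond; apply: leq_prod => p.
  rewrite andbT => /andP[_ lt_pm]; case: ifP => [p_pr|]; last first.
    by move=> pNpr; rewrite expn_gt0 lognE pNpr orbT.
  rewrite leq_exp2l ?prime_gt1 // logn_fact // big_ltn ?expn1 ?leq_addr //.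
  by apply: leq_trans lt_pm; exact/leqW/prime_gt1.
under eq_bigr do rewrite expnS.
rewrite big_split /= expnMn leq_mul ?primorial_leq //.
exact: leq_trans (fact_leq_expn m).
Qed.

(** Multiplying by [m], replacing [m / p] by the larger integer [(m %/ p).+1] and exponentiating
    reduces this to the preceding product bound. *)
Lemma sum_ln_prime_div_le (R : realType) (m : nat) : (0 < m)%N ->
  \sum_(0 <= p < m.+1 | prime p) ln p%:R / p%:R <= ln (4 * m%:R) :> R.
Proof.
move=> m_gt0; have m0 : 0 < m%:R :> R by rewrite ltr0n.
rewrite -(ler_pM2l m0) mulr_sumr.
apply: (@le_trans _ _ (\sum_(0 <= p < m.+1 | prime p) (m %/ p).+1%:R * ln p%:R)).
  apply: ler_sum => p p_pr; have p0 : 0 < p%:R :> R by rewrite ltr0n prime_gt0.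
  rewrite mulrCA mulrC ler_wpM2r ?ln_ge0 ?ler1n ?prime_gt0 //.
  by rewrite ler_pdivrMr // -natrM ler_nat ltnW // ltn_ceil ?prime_gt0.
rewrite -ler_expR expR_sum expRM_natl lnK ?posrE ?mulr_gt0 //.
under eq_bigr => p p_pr do rewrite expRM_natl lnK ?posrE ?ltr0n ?prime_gt0 // -natrX.
by rewrite -natr_prod -natrM -natrX ler_nat prod_primes_expn_divn_leq.
Qed.

(* Abel summation of [1/p = (ln p / p) (1 / ln p)], done by induction on [m]. *)
Lemma sum_inv_prime_le_aux (R : realType) (m : nat) : (1 < m)%N ->
  \sum_(0 <= p < m.+1 | prime p) p%:R^-1 <=
    (\sum_(0 <= p < m.+1 | prime p) ln p%:R / p%:R) / ln m%:R
      + ln (ln m%:R) - ln (ln 2) + ln 4 * ((ln 2)^-1 - (ln m%:R)^-1) :> R.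
Proof.
elim: m => // -[//|[_ _|m IHm _]].
  have ln2 : 0 < ln (2 : R) by rewrite ln_gt0 ?ltr1n.
  by rewrite unlock /= !addr0 subrr mulr0 addr0 addrK mulrAC divff ?gt_eqF // mul1r.
set S := fun k => \sum_(0 <= p < k.+1 | prime p) ln p%:R / p%:R : R.
set T := fun k => \sum_(0 <= p < k.+1 | prime p) p%:R^-1 : R.
have {}IHm := IHm isT; rewrite -/(S m.+2) -/(T m.+2) in IHm.
rewrite -/(S m.+3) -/(T m.+3).
have lnm : 0 < ln (m.+2%:R : R) by rewrite ln_gt0 ?ltr1n.
have lnm1 : 0 < ln (m.+3%:R : R) by rewrite ln_gt0 ?ltr1n.
have le_ln : ln (m.+2%:R : R) <= ln m.+3%:R by rewrite ler_ln ?posrE ?ltr0n ?ler_nat.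
have ET : T m.+3 - T m.+2 = (S m.+3 - S m.+2) / ln m.+3%:R.
  rewrite /S /T big_mkcond big_nat_recr //= -big_mkcond /=.
  rewrite [in RHS]big_mkcond [in RHS]big_nat_recr //= -[in RHS]big_mkcond /=.
  case: ifP => _; last by rewrite !addr0 !subrr mul0r.
  by rewrite ![_ + _ - _]addrAC !subrr !add0r mulrAC divff ?gt_eqF // mul1r.
have inv_le : 0 <= (ln m.+2%:R)^-1 - (ln m.+3%:R)^-1 :> R.
  by rewrite subr_ge0 lef_pV2 ?posrE.
have S_le : S m.+2 <= ln 4 + ln m.+2%:R.
  by rewrite -lnM ?posrE ?ltr0n // sum_ln_prime_div_le.
have := ler_wpM2r inv_le S_le.
(* Discrete substitute for integrating [1 / (t ln t)]: it is [ln z <= z - 1] at the quotient [z] of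
   the two logarithms. *)
have : 1 - ln m.+2%:R / ln m.+3%:R <= ln (ln m.+3%:R) - ln (ln m.+2%:R) :> R.
  have := @ln_sublinear R (ln m.+2%:R / ln m.+3%:R).
  have : ln (1 + (ln m.+2%:R / ln m.+3%:R - 1)) <= ln m.+2%:R / ln m.+3%:R - 1 :> R.
    by apply: le_ln1Dx; rewrite ltrBrDl subrr divr_gt0.
  by rewrite addrCA subrr addr0 ln_div ?posrE //; lra.
have : ln m.+2%:R * (ln m.+2%:R)^-1 = 1 :> R by rewrite divff ?gt_eqF.
move: IHm ET; set u := (ln m.+2%:R)^-1; set v := (ln m.+3%:R)^-1.
nra.
Qed.

(** The first-moment bound gives [1 + ln 4 / ln m] for the quotient term; the second summand
    cancels, and [3] is [1 + ln 4 / ln 2]. *)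
Lemma sum_inv_prime_le (R : realType) (m : nat) : (1 < m)%N ->
  \sum_(0 <= p < m.+1 | prime p) p%:R^-1 <= ln (ln m%:R) + (3 - ln (ln 2)) :> R.
Proof.
move=> m_gt1; apply: le_trans (sum_inv_prime_le_aux R m_gt1) _.
have lnm : 0 < ln (m%:R : R) by rewrite ln_gt0 ?ltr1n.
have ln2 : 0 < ln (2 : R) by rewrite ln_gt0 ?ltr1n.
have := @sum_ln_prime_div_le R m (ltnW m_gt1).
rewrite lnM ?posrE ?ltr0n 1?ltnW // -(ler_pM2r (_ : 0 < (ln m%:R)^-1)) ?invr_gt0 //.
have -> : ln 4 = 2 * ln 2 :> R.
  by rewrite (_ : 4 = 2 ^+ 2) ?lnXn ?mulr_natl // -natrX.
rewrite mulrDl divff ?gt_eqF // => S_le.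
rewrite mulrBr mulfK ?gt_eqF //; lra.
Qed.

(** Nonnegative terms allow dropping [P], after which the sum telescopes. With [P] the primes it
    bounds the tail of the sum of [1 / (p (p - 1))]. *)
Lemma sum_inv_consecutive_le (R : realType) (P : pred nat) (k m : nat) : (0 < k)%N ->
  \sum_(k.+1 <= i < m | P i) (i.-1%:R^-1 - i%:R^-1) <= k%:R^-1 :> R.
Proof.
move=> k_gt0; have [lt_km|le_mk] := ltnP k m; last first.
  by rewrite big_geq ?invr_ge0 // leqW.
have term_ge0 i : (k < i)%N -> 0 <= i.-1%:R^-1 - i%:R^-1 :> R.
  move=> lt_ki; rewrite subr_ge0 lef_pV2 ?posrE ?ltr0n ?ler_nat //; lia.
apply: (@le_trans _ _ (\sum_(k.+1 <= i < m) (i.-1%:R^-1 - i%:R^-1))).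
  rewrite big_mkcond big_nat_cond [leRHS]big_nat_cond.
  apply: ler_sum => i; rewrite andbT => /andP[/term_ge0 ? _].
  by case: ifP.
rewrite (telescope_sumr_eq (fun i => - i.-1%:R^-1)) //=; last first.
  by move=> i _; rewrite opprK addrC.
by rewrite opprK addrC gerDl oppr_le0 invr_ge0.
Qed.

(** Each factor is at most [exp (1 / (p - 1))]; passing from [1 / (p - 1)] to [1 / p] costs at most
    [1] in total, which turns [3] into [4]. *)
Lemma prod_prime_ratio_le (R : realType) (m : nat) : (1 < m)%N ->
  \prod_(0 <= p < m.+1 | prime p) (p%:R / p.-1%:R) <=
    expR (4 - ln (ln 2)) * ln m%:R :> R.
Proof.
move=> m_gt1; have lnm : 0 < ln (m%:R : R) by rewrite ln_gt0 ?ltr1n.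
rewrite -[X in _ * X]lnK ?posrE // -expRD.
apply: (@le_trans _ _ (expR (\sum_(0 <= p < m.+1 | prime p) p.-1%:R^-1))).
  rewrite expR_sum; apply: ler_prod => p p_pr.
  rewrite divr_ge0 //=; apply: le_trans (expR_ge1Dx _).
  have p1 : p.-1%:R != 0 :> R by rewrite pnatr_eq0; have := prime_gt1 p_pr; lia.
  by rewrite -{1}(prednK (prime_gt0 p_pr)) -natr1 mulrDl mul1r divff.
rewrite ler_expR.
have := @sum_inv_consecutive_le R prime 1 m.+1 isT.
rewrite sumrB invr1.
have shift (F : nat -> R) :
    \sum_(0 <= p < m.+1 | prime p) F p = \sum_(2 <= p < m.+1 | prime p) F p.
  by rewrite big_ltn_cond //= big_ltn_cond ?ltnS 1?ltnW.
rewrite -!shift; have := @sum_inv_prime_le R m m_gt1; lra.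
Qed.

(** * The totient ratio as a product over primes, and averages over full periods *)

Lemma totient_ratioE (R : realType) (M : nat) : (0 < M)%N ->
  M%:R / (totient M)%:R = \prod_(p <- primes M) (p%:R / p.-1%:R) :> R.
Proof.
move=> M_gt0; rewrite totientE // {1}(prod_prime_decomp M_gt0) prime_decompE.
rewrite big_map /= !natr_prod -prodf_div !big_seq.
apply: eq_bigr => p; rewrite mem_primes => /and3P[p_pr _ p_dvd].
have l_gt0 : (0 < logn p M)%N by rewrite logn_gt0 mem_primes p_pr M_gt0.
have p_neq0 : p%:R != 0 :> R by rewrite pnatr_eq0 -lt0n prime_gt0.
rewrite -{1}(prednK l_gt0) expnS !natrM -mulf_div divff ?mulr1 //.
by rewrite natrX expf_neq0.
Qed.

Lemma big_primes_range (R : comPzSemiRingType) (M a b : nat) (G : nat -> R) : (0 < M)%N ->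
  \prod_(p <- primes M | (a <= p < b)%N) G p =
    \prod_(a <= p < b | prime p && (p %| M)%N) G p.
Proof.
move=> M_gt0; rewrite -big_filter -[RHS]big_filter; apply: perm_big.
apply: uniq_perm; rewrite ?filter_uniq ?primes_uniq ?iota_uniq // => p.
by rewrite !mem_filter mem_primes mem_index_iota M_gt0 andbC.
Qed.

Lemma sum_nat_blocks (V : nmodType) (k P : nat) (g : nat -> V) :
  \sum_(0 <= n < k * P) g n = \sum_(0 <= j < k) \sum_(0 <= a < P) g (a + j * P)%N.
Proof.
rewrite big_nat_mul; apply: eq_bigr => j _.
by rewrite -{1}(add0n (j * P)%N) big_addn mulSn addnK.
Qed.

(** The range is covered by [N %/ P + 1] full periods, whose total length is at most [2 N] because
    [P <= N]. *)
Lemma sum_periodic_le (R : numDomainType) (g : nat -> R) (P N : nat) :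
  (forall n, 0 <= g n) -> (forall n k, g (n + k * P)%N = g n) -> (0 < P <= N)%N ->
  P%:R * \sum_(1 <= n < N.+1) g n <= 2 * N%:R * \sum_(0 <= n < P) g n.
Proof.
move=> g_ge0 gP /andP[P_gt0 le_PN]; set k := (N %/ P).+1.
have le_Nk : (N.+1 <= k * P)%N by rewrite /k ltn_ceil.
have le_sum : \sum_(1 <= n < N.+1) g n <= k%:R * \sum_(0 <= n < P) g n.
  apply: (@le_trans _ _ (\sum_(0 <= n < k * P) g n)).
    rewrite [leRHS]big_ltn; last exact: leq_trans le_Nk.
    rewrite [leRHS]addrC [X in _ <= X + _](big_cat_nat (n := N.+1)) //= -addrA lerDl.
    by rewrite addr_ge0 // sumr_ge0.
  rewrite sum_nat_blocks; under eq_bigr do under eq_bigr do rewrite gP.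
  by rewrite sumr_const_nat subn0 mulr_natl.
apply: (le_trans (ler_wpM2l _ le_sum)); rewrite ?ler0n // mulrA -!natrM.
rewrite ler_wpM2r ?sumr_ge0 // ler_nat /k mulnS mulnC.
have := leq_divM N P; lia.
Qed.

(* Over a full period the conditions [p %| F n] for distinct primes [p] are
   independent, each holding with probability at most [D / p]. *)
Lemma sum_period_prod_le (R : realType) (F : nat -> nat) (D : nat) (b : nat -> R)
    (Q : seq nat) :
  (forall p, 0 <= b p) ->
  (forall p n k, prime p -> (p %| F (n + k * p))%N = (p %| F n)%N) ->
  (forall p a P, prime p -> coprime p P ->
     (\sum_(0 <= j < p) (p %| F (a + j * P)) <= D)%N) ->
  uniq Q -> all prime Q ->
  \sum_(0 <= n < \prod_(p <- Q) p) \prod_(p <- Q) (1 + b p * (p %| F n)%:R) <=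
    (\prod_(p <- Q) p)%:R * \prod_(p <- Q) (1 + b p * (D%:R / p%:R)).
Proof.
move=> b_ge0 F_per F_root; elim: Q => [|p Q IHQ] /=.
  by rewrite !big_nil big_nat1 big_nil mulr1.
case/andP=> pNQ uQ /andP[p_pr Q_pr].
have {}IHQ := IHQ uQ Q_pr; have copQ := coprime_prime_prod p_pr Q_pr pNQ.
have dvdQ q : q \in Q -> (q %| \prod_(r <- Q) r)%N.
  by move=> qQ; rewrite (big_rem q) //= dvdn_mulr.
(* Chinese remaindering by hand: with [n = a + j * P], the residue [a] fixes the factors of [Q], and
   for fixed [a] only the factor at [p] varies with [j]. *)
rewrite [in leLHS]big_cons sum_nat_blocks exchange_big_nat /=.
move: copQ dvdQ IHQ; set P := (\prod_(r <- Q) r)%N => copQ dvdQ IHQ.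
have p0 : 0 < p%:R :> R by rewrite ltr0n prime_gt0.
apply: (@le_trans _ _ (\sum_(0 <= a < P)
    (p%:R * (1 + b p * (D%:R / p%:R))) * \prod_(q <- Q) (1 + b q * (q %| F a)%:R))).
  apply: ler_sum => a _.
  have per j : \prod_(q <- p :: Q) (1 + b q * (q %| F (a + j * P)%N)%:R) =
      (1 + b p * (p %| F (a + j * P)%N)%:R) * \prod_(q <- Q) (1 + b q * (q %| F a)%:R).
    rewrite big_cons; congr (_ * _); rewrite !big_seq; apply: eq_bigr => q qQ.
    have /dvdnP[k ->] := dvdQ q qQ.
    by rewrite mulnA F_per // (allP Q_pr).
  under eq_bigr do rewrite per.
  rewrite -mulr_suml ler_wpM2r ?prodr_ge0 // => [q _|].
    by rewrite addr_ge0 // mulr_ge0.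
  rewrite big_split /= sumr_const_nat subn0 -mulr_sumr -natr_sum mulrDr mulr1.
  by rewrite lerD2l [leRHS]mulrCA ler_wpM2l // [leRHS]mulrC divfK ?gt_eqF // ler_nat F_root.
rewrite -mulr_sumr !big_cons natrM.
rewrite [leRHS]mulrACA ler_wpM2l // mulr_ge0 // addr_ge0 // mulr_ge0 //.
by rewrite divr_ge0.
Qed.

(** * Large primes, middle primes, and the resulting moment bound *)

(** The product of [Q] divides [M], so [Q] has at most [E] elements, and each contributes at most
    [1 + 1 / y]. *)
Lemma prod_large_primes_le (R : realType) (Q : seq nat) (y M E : nat) :
  (0 < y)%N -> (0 < M)%N -> (M <= y.+1 ^ E)%N ->
  uniq Q -> all prime Q -> all (dvdn^~ M) Q -> all (leq y.+1) Q ->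
  \prod_(p <- Q) (p%:R / p.-1%:R) <= expR (E%:R / y%:R) :> R.
Proof.
move=> y_gt0 M_gt0 le_M uQ Q_pr Q_dvd Q_ge.
have le_size : (size Q <= E)%N.
  rewrite -(@leq_exp2l y.+1) //; apply: leq_trans le_M.
  apply: leq_trans (dvdn_leq M_gt0 (prod_primes_dvd uQ Q_pr Q_dvd)).
  elim: Q Q_ge {uQ Q_pr Q_dvd} => [|p Q IHQ] /=; first by rewrite big_nil.
  by case/andP=> le_yp /IHQ; rewrite big_cons expnS; exact: leq_mul.
have y0 : 0 < y%:R :> R by rewrite ltr0n.
apply: (@le_trans _ _ (\prod_(p <- Q) expR y%:R^-1)).
  rewrite !big_seq; apply: ler_prod => p pQ; rewrite divr_ge0 //=.
  have le_yp := allP Q_ge p pQ; have p_gt0 : (0 < p)%N by apply: leq_trans le_yp.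
  have p1 : p.-1%:R != 0 :> R by rewrite pnatr_eq0; lia.
  apply: le_trans (expR_ge1Dx _).
  rewrite -{1}(prednK p_gt0) -natr1 mulrDl mul1r divff // lerD2l.
  by rewrite lef_pV2 ?posrE ?ler_nat ?ltr0n //; lia.
rewrite -expR_sum ler_expR big_const_seq count_predT iter_addr addr0.
by rewrite -[_ *+ size Q]mulr_natl ler_wpM2r ?invr_ge0 // ler_nat.
Qed.

Lemma bernoulli_sub_le (R : realDomainType) (x : R) (s : nat) :
  0 <= x <= 1 -> 1 - s%:R * x <= (1 - x) ^+ s.
Proof.
case/andP=> x_ge0 x_le1; elim: s => [|s IHs]; first by rewrite mul0r subr0.
rewrite exprS; have := ler_wpM2l (_ : 0 <= 1 - x) IHs; rewrite subr_ge0 => /(_ x_le1).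
apply: le_trans; rewrite -natr1.
have : 0 <= s%:R * x * x by rewrite !mulr_ge0.
lra.
Qed.

(** With [u = s / p <= 1 / 2], Bernoulli bounds the power by [1 / (1 - u)], which is at most
    [1 + 2 u]. *)
Lemma prime_ratio_expn_le (R : realType) (p s : nat) : (2 * s < p)%N ->
  (p%:R / p.-1%:R) ^+ s <= 1 + 2 * s%:R / p%:R :> R.
Proof.
case: s => [|s]; first by rewrite mulr0 mul0r addr0.
move=> lt_sp; have p0 : 0 < p%:R :> R by rewrite ltr0n; lia.
have p1 : 0 < p.-1%:R :> R by rewrite ltr0n; lia.
have Ep : p.-1%:R / p%:R = 1 - p%:R^-1 :> R.
  have -> : p.-1%:R = p%:R - 1 :> R by rewrite -subn1 natrB //; lia.
  by rewrite mulrBl divff ?gt_eqF // mul1r.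
rewrite -invf_div Ep exprVn.
have lt_s : 2 * (s.+1%:R / p%:R) <= 1 :> R.
  by rewrite mulrA ler_pdivrMr // mul1r -natrM ler_nat ltnW.
have s0 : 0 <= s.+1%:R / p%:R :> R by rewrite divr_ge0.
have x01 : 0 <= (p%:R^-1 : R) <= 1.
  by rewrite invr_ge0 ler0n invf_le1 // ler1n; lia.
have := @bernoulli_sub_le R _ s.+1 x01; rewrite -mulrA.
move: s0 lt_s; set u := s.+1%:R / _ => s0 lt_s bern.
have u1 : 0 < 1 - u by lra.
apply: (@le_trans _ _ (1 - u)^-1).
  by rewrite lef_pV2 ?posrE // (lt_le_trans u1).
by rewrite -[leLHS]mul1r ler_pdivrMr //; nra.
Qed.

Lemma sum_middle_primes_le (R : realType) (F : nat -> nat) (D s y N : nat) :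
  (forall p n k, prime p -> (p %| F (n + k * p))%N = (p %| F n)%N) ->
  (forall p a P, prime p -> coprime p P ->
     (\sum_(0 <= j < p) (p %| F (a + j * P)) <= D)%N) ->
  (0 < s)%N -> (y`! <= N)%N ->
  \sum_(1 <= n < N.+1) \prod_((2 * s).+1 <= p < y.+1 | prime p)
      (1 + 2 * s%:R / p%:R * (p %| F n)%:R) <= 2 * N%:R * expR D%:R :> R.
Proof.
move=> F_per F_root s_gt0 le_yN.
pose Q := [seq p <- index_iota (2 * s).+1 y.+1 | prime p].
pose b p : R := 2 * s%:R / p%:R.
have b_ge0 p : 0 <= b p by rewrite divr_ge0 ?mulr_ge0.
have uQ : uniq Q by rewrite filter_uniq ?iota_uniq.
have Q_pr : all prime Q by exact: filter_all.
have memQ p : p \in Q -> [/\ prime p, (2 * s < p)%N & (p <= y)%N].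
  by rewrite mem_filter mem_index_iota ltnS => /and3P[].
set P := (\prod_(p <- Q) p)%N.
have P_gt0 : (0 < P)%N.
  by rewrite /P big_seq; apply: prodn_cond_gt0 => p /memQ[/prime_gt0].
have le_PN : (P <= N)%N.
  apply: leq_trans le_yN; apply: dvdn_leq; first exact: fact_gt0.
  apply: prod_primes_dvd => //; apply/allP => p /memQ[p_pr _ le_py] /=.
  by rewrite dvdn_fact // prime_gt0.
pose g n := \prod_(p <- Q) (1 + b p * (p %| F n)%:R).
have g_ge0 n : 0 <= g n by apply: prodr_ge0 => p _; rewrite addr_ge0 // mulr_ge0.
have g_per n k : g (n + k * P)%N = g n.
  rewrite /g !big_seq; apply: eq_bigr => p pQ; have [p_pr _ _] := memQ p pQ.
  have /dvdnP[m ->] : (p %| P)%N by rewrite /P (big_rem p) //= dvdn_mulr.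
  by rewrite mulnA F_per.
under eq_bigr do rewrite -big_filter -/Q.
have P0 : 0 < P%:R :> R by rewrite ltr0n.
rewrite -(ler_pM2l P0).
apply: le_trans (sum_periodic_le g_ge0 g_per _) _; first by rewrite P_gt0.
rewrite [leRHS]mulrCA ler_wpM2l ?mulr_ge0 //.
apply: le_trans (sum_period_prod_le b_ge0 F_per F_root uQ Q_pr) _.
rewrite ler_wpM2l //.
(* The exponent is [2 s D] times a sum of [1 / p^2] over primes beyond [2 s]; comparison with
   [1 / (p (p - 1))] bounds that sum by [1 / (2 s)], leaving [D]. *)
apply: (@le_trans _ _ (expR (\sum_(p <- Q) b p * (D%:R / p%:R)))).
  rewrite expR_sum; apply: ler_prod => p _.
  by rewrite expR_ge1Dx andbT addr_ge0 // mulr_ge0 // divr_ge0.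
rewrite ler_expR.
have s0 : 0 < (2 * s)%:R :> R by rewrite ltr0n muln_gt0.
have := @sum_inv_consecutive_le R prime (2 * s) y.+1.
rewrite muln_gt0 s_gt0 => /(_ isT); rewrite -big_filter -/Q => sum_le.
rewrite -[leRHS](mulfK (lt0r_neq0 s0)); apply: le_trans (ler_wpM2l _ sum_le); last first.
  by rewrite mulr_ge0.
rewrite mulr_sumr !big_seq; apply: ler_sum => p /memQ[p_pr lt_sp _].
have p1 : 0 < p.-1%:R :> R by rewrite ltr0n; have := prime_gt1 p_pr; lia.
have Ep : p%:R = p.-1%:R + 1 :> R by rewrite natr1 prednK ?prime_gt0.
rewrite /b natrM Ep.
have -> : (p.-1%:R)^-1 - (p.-1%:R + 1)^-1 = (p.-1%:R)^-1 / (p.-1%:R + 1) :> R.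
  by field; rewrite !gt_eqF // addr_gt0.
have -> : 2 * s%:R / (p.-1%:R + 1) * (D%:R / (p.-1%:R + 1)) =
  D%:R * (2 * s%:R) * ((p.-1%:R + 1)^-1 / (p.-1%:R + 1)) :> R by ring.
rewrite ler_wpM2l ?mulr_ge0 // ler_wpM2r ?invr_ge0 ?addr_ge0 //.
by rewrite lef_pV2 ?posrE ?addr_gt0 // lerDl.
Qed.

(** The polynomial enters only through positivity, growth, periodicity modulo primes and the number
    of roots modulo primes, so [F] is kept abstract. *)
Lemma totient_moment_le (R : realType) (F : nat -> nat) (A D s N : nat) :
  (forall n, (0 < n)%N -> (0 < F n)%N) ->
  (forall n, (0 < n <= N)%N -> (F n <= A * N ^ D)%N) ->
  (forall p n k, prime p -> (p %| F (n + k * p))%N = (p %| F n)%N) ->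
  (forall p a P, prime p -> coprime p P ->
     (\sum_(0 <= j < p) (p %| F (a + j * P)) <= D)%N) ->
  (0 < s)%N -> (0 < N)%N ->
  \sum_(1 <= n < N.+1) ((F n)%:R / (totient (F n))%:R) ^+ s <=
    (expR (4 - ln (ln 2)) * ln (2 * s)%:R * expR (A + 2 * D)%:R) ^+ s
      * (2 * N%:R * expR D%:R) :> R.
Proof.
move=> F_gt0 F_le F_per F_root s_gt0 N_gt0.
have [y [y_gt0 le_yN lt_Ny]] : exists y, [/\ (0 < y)%N, (y`! <= N)%N & (N < y.+1`!)%N].
  have fact_bound i : (i`! <= N)%N -> (i <= N)%N by exact: leq_trans (fact_geq i).
  have ex1 : exists i, (i`! <= N)%N by exists 1%N.
  case: (ex_maxnP ex1 fact_bound) => y le_yN y_max; exists y; split=> //.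
    exact: (y_max 1%N).
  by rewrite ltnNge; apply/negP => /y_max; rewrite ltnn.
pose E := (A + D * y.+1)%N.
(* Here [A < y.+1 ^ A] absorbs the constant, and [N < y.+1! <= y.+1 ^ y.+1] handles [N ^ D]. *)
have F_le_exp n : (0 < n <= N)%N -> (F n <= y.+1 ^ E)%N.
  move/F_le/leq_trans; apply; rewrite /E expnD mulnC [X in (_ <= X)%N]mulnC.
  apply: leq_mul; last by apply/ltnW/ltn_expl.
  rewrite mulnC expnM; case: (D) => // d; rewrite leq_exp2r //.
  exact: leq_trans (ltnW lt_Ny) (fact_leq_expn _).
pose small : R := expR (4 - ln (ln 2)) * ln (2 * s)%:R.
pose large : R := expR (A + 2 * D)%:R.
pose middle n : R := \prod_((2 * s).+1 <= p < y.+1 | prime p)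
      (1 + 2 * s%:R / p%:R * (p %| F n)%:R).
have ratio_ge0 (p : nat) : 0 <= p%:R / p.-1%:R :> R by rewrite divr_ge0.
have term_le n : (0 < n <= N)%N ->
    ((F n)%:R / (totient (F n))%:R) ^+ s <= (small * large) ^+ s * middle n.
  move=> n_range; have Fn_gt0 : (0 < F n)%N by apply: F_gt0; case/andP: n_range.
  rewrite totient_ratioE // (bigID (fun p => (0 <= p < (2 * s).+1)%N)) /=.
  rewrite [X in _ * X](bigID (fun p => ((2 * s).+1 <= p < y.+1)%N)) /=.
  (* The middle primes go last: the small and large ones are bounded for each [n], the middle ones
     only on average. *)
  rewrite (mulrC (\prod_(_ <- _ | _ && (_ < _ < _)%N) _)) mulrA exprMn.
  apply: ler_pM; rewrite ?exprn_ge0 ?mulr_ge0 ?prodr_ge0 //.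
    apply: lerXn2r; rewrite ?nnegrE ?mulr_ge0 ?prodr_ge0 ?expR_ge0 //.
      by rewrite ln_ge0 // ler1n muln_gt0.
    apply: ler_pM; rewrite ?prodr_ge0 //.
      rewrite (big_primes_range 0) //.
      apply: le_trans (@prod_prime_ratio_le R (2 * s) _); last by lia.
      (* Since [p / (p - 1) >= 1], dropping the condition [p %| F n] only increases the product. *)
      rewrite big_mkcondr; apply: ler_prod => p p_pr.
      have p1 : 0 < p.-1%:R :> R by rewrite ltr0n; have := prime_gt1 p_pr; lia.
      by case: ifP => _; rewrite ?ratio_ge0 ?ler01 ?lexx //= ler_pdivlMr // mul1r ler_nat leq_pred.
    rewrite -big_filter.
    apply: le_trans (prod_large_primes_le R y_gt0 Fn_gt0 (F_le_exp _ n_range) _ _ _ _) _.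
    - by rewrite filter_uniq ?primes_uniq.
    - by apply/allP => p; rewrite mem_filter mem_primes => /andP[_ /andP[]].
    - by apply/allP => p; rewrite mem_filter mem_primes => /andP[_ /and3P[]].
    - by apply/allP => p; rewrite mem_filter => /andP[]; lia.
    (* As [y >= 1], both [A / y <= A] and [(y + 1) / y <= 2]. *)
    rewrite ler_expR ler_pdivrMr ?ltr0n // -natrM ler_nat /E; nia.
  rewrite (eq_bigl (fun p => ((2 * s).+1 <= p < y.+1)%N)); last by move=> p; lia.
  rewrite big_primes_range // -prodrXl big_mkcondr /middle.
  rewrite big_nat_cond [leRHS]big_nat_cond.
  apply: ler_prod => p /andP[/andP[lt_sp _] _].
  case: ifP => _; last by rewrite mulr0 addr0 ler01 lexx.
  by rewrite exprn_ge0 // mulr1 prime_ratio_expn_le.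
apply: (@le_trans _ _ ((small * large) ^+ s * \sum_(1 <= n < N.+1) middle n)).
  rewrite mulr_sumr big_nat_cond [leRHS]big_nat_cond; apply: ler_sum => n.
  by rewrite andbT ltnS => /term_le.
apply: ler_wpM2l; last exact: sum_middle_primes_le.
by rewrite exprn_ge0 // !mulr_ge0 ?expR_ge0 // ln_ge0 // ler1n muln_gt0.
Qed.

(** * Values of the polynomial: periodicity, roots modulo primes, growth *)

Lemma dvdn_natval (f : {poly int}) (p n : nat) : prime p ->
  (p %| natval f n)%N = root (map_poly intr f : {poly 'F_p}) n%:R.
Proof.
move=> p_pr; have -> : (p %| natval f n)%N = (p%:Z %| f.[n%:Z])%Z by [].
by rewrite (dvdz_pcharf (pchar_Fp p_pr)) -horner_map.
Qed.

Lemma dvdn_natval_periodic (f : {poly int}) (p n k : nat) : prime p ->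
  (p %| natval f (n + k * p))%N = (p %| natval f n)%N.
Proof.
by move=> p_pr; rewrite !dvdn_natval // natrD natrM pchar_Fp_0 // mulr0 addr0.
Qed.

(** Content [1] keeps [f] nonzero modulo [p], and coprimality makes the points [a + j * P] distinct
    in ['F_p]; a nonzero polynomial over a field has at most its degree many roots. *)
Lemma count_natval_roots_leq (f : {poly int}) (p a P : nat) :
  zcontents f = 1 -> prime p -> coprime p P ->
  (\sum_(0 <= j < p) (p %| natval f (a + j * P)) <= (size f).-1)%N.
Proof.
move=> f_gcd p_pr copP; set fp : {poly 'F_p} := map_poly intr f.
have pchar_p := pchar_Fp p_pr.
have fp_neq0 : fp != 0.
  apply/eqP => fp0; have : (p%:Z %| zcontents f)%Z.
    rewrite dvdz_contents; apply/polyOverP => i; rewrite (dvdz_pcharf pchar_p).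
    by rewrite -coef_map -/fp fp0 coef0.
  by rewrite f_gcd dvdzE /= dvdn1 => /eqP p1; rewrite p1 in p_pr.
pose rs : seq 'F_p :=
  [seq (a + j * P)%:R | j <- index_iota 0 p & (p %| natval f (a + j * P))%N].
have -> : (\sum_(0 <= j < p) (p %| natval f (a + j * P)) = size rs)%N.
  by rewrite size_map size_filter -sum1_count [RHS]big_mkcond.
have rs_roots : all (root fp) rs.
  by apply/allP => _ /mapP[j + ->]; rewrite mem_filter dvdn_natval // => /andP[].
have rs_uniq : uniq rs.
  rewrite map_inj_in_uniq ?filter_uniq ?iota_uniq // => i j.
  rewrite !mem_filter !mem_index_iota => /and3P[_ _ lt_ip] /and3P[_ _ lt_jp].
  wlog le_ij : i j lt_ip lt_jp / (i <= j)%N.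
    by move=> IH; case/orP: (leq_total i j) => [/IH|/IH sym /esym/sym ->]; auto.
  move/esym/eqP; rewrite -subr_eq0 -natrB; last by rewrite leq_add2l leq_mul2r le_ij orbT.
  rewrite -(dvdn_pcharf pchar_p) subnDl -mulnBl Gauss_dvdl //.
  have [|lt_ij] := leqP j i; first by move=> le_ji _; apply/eqP; rewrite eqn_leq le_ij.
  move/dvdn_leq; rewrite subn_gt0 => /(_ lt_ij); lia.
have size_fp : (size fp <= size f)%N.
  by rewrite /fp map_polyE (leq_trans (size_Poly _)) ?size_map.
have lt_rs := leq_trans (max_poly_roots fp_neq0 rs_roots rs_uniq) size_fp.
by rewrite -ltnS prednK // (leq_trans _ lt_rs).
Qed.

Lemma natval_leq (f : {poly int}) (n N : nat) : (0 < N)%N -> (n <= N)%N ->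
  (natval f n <= (\sum_(i < size f) absz (f`_i)%R) * N ^ (size f).-1)%N.
Proof.
move=> N_gt0 le_nN; rewrite -lez_nat /natval abszE horner_coef.
apply: le_trans (ler_norm_sum _ _ _) _.
rewrite PoszM -[X in X * _]natz natr_sum mulr_suml.
apply: ler_sum => i _; rewrite normrM natz abszE ler_wpM2l //.
rewrite -abszE lez_nat abszX /=.
apply: leq_trans (_ : N ^ i <= _)%N; first by case: (val i) => // k; rewrite leq_exp2r.
by rewrite leq_pexp2l // -ltnS (leq_trans (ltn_ord i)) // leqSpred.
Qed.

(** * From moments to the tail, and the choice of constants *)

Lemma tail_of_moments (R : realType) (r : nat -> R) (C x t : R) (N : nat) :
  (forall n, 0 <= r n) -> N%:R <= x -> 0 < t ->
  (forall s, (0 < s)%N -> \sum_(1 <= n < N.+1) r n ^+ s <=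
     expR (s%:R * ln (ln (s%:R + 2)) + C * s%:R) * x) ->
  #|[set n : 'I_N.+1 | (0 < n)%N && (t < r n)]|%:R <=
    expR 3 * expR (- expR (expR (- C - 1) * t)) * x.
Proof.
move=> r_ge0 le_Nx t_gt0 moment.
have x_ge0 : 0 <= x by apply: le_trans le_Nx.
set K := #|_|.
have EK : K = (\sum_(1 <= n < N.+1) (t < r n)%R)%N.
  rewrite /K cardsE -sum1_card -(big_mkord (fun n => (0 < n)%N && (t < r n)) (fun=> 1%N)).
  rewrite big_mkcond big_ltn //= add0n !big_nat.
  by apply: eq_bigr => -[//|n] _ /=; case: ifP.
have le_KN : (K <= N)%N.
  rewrite EK -[leqRHS]muln1 -[X in (_ <= X * _)%N](subn1 N.+1) -sum_nat_const_nat.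
  by apply: leq_sum => n _; case: (t < r n)%R.
set u := expR (_ * t); rewrite -expRD.
(* The claim is now [K <= exp (3 - u) x]; for [u < 3] it follows from the trivial bound [K <= N]. *)
have [lt_u3|le_3u] := ltP u 3.
  apply: le_trans (_ : x <= _); first by apply: le_trans le_Nx; rewrite ler_nat.
  by rewrite -[leLHS]mul1r ler_wpM2r // -[leLHS]expR0 ler_expR subr_ge0 ltW.
have u_ge0 : 0 <= u by rewrite expR_ge0.
have le3 : (3 <= Num.truncn u)%N by rewrite truncn_ge_nat.
have /andP[le_u lt_u] := truncn_itv u_ge0.
(* The moment of order [s.+1] is used: its shifted argument [(s + 1) + 2] is the integer part of
   [u], so its logarithm is at most [ln u], while [s + 1 > u - 3]. *)
have [s Es] : {s | Num.truncn u = s.+3} by exists (Num.truncn u - 3)%N; lia.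
rewrite {}Es -!natr1 in le_u lt_u.
have := moment s.+1 isT; rewrite -natr1 -addrA.
set L := ln (s%:R + _) => moment_s.
have s0 : 0 <= s%:R :> R by [].
have L_gt0 : 0 < L by rewrite ln_gt0 //; lra.
have L_le : L <= expR (- C - 1) * t.
  by rewrite -[leRHS]expRK ler_ln ?posrE ?expR_gt0 //; [rewrite -/u; lra | lra].
have markov : K%:R * t ^+ s.+1 <= \sum_(1 <= n < N.+1) r n ^+ s.+1.
  rewrite EK natr_sum mulr_suml; apply: ler_sum => n _.
  case: (ltP t (r n)) => [/ltW le_tr|_]; last by rewrite mul0r exprn_ge0.
  by rewrite mul1r lerXn2r ?nnegrE // ltW.
have t0 : 0 < t ^+ s.+1 by rewrite exprn_gt0.
rewrite -(ler_pM2r t0); apply: le_trans markov (le_trans moment_s _).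
rewrite [leRHS]mulrAC ler_wpM2r // natr1.
rewrite [C * _]mulrC -mulrDr expRM_natl [expR (_ + C)]expRD lnK ?posrE //.
(* The summand [-1] in the exponent [- C - 1] leaves a factor [1 / e] per power, hence the decay
   [exp (- (s + 1))]. *)
apply: (@le_trans _ _ ((expR (-1) * t) ^+ s.+1)).
  apply: lerXn2r; rewrite ?nnegrE ?mulr_ge0 ?expR_ge0 ?(ltW L_gt0) ?(ltW t_gt0) //.
  rewrite -ler_pdivlMr ?expR_gt0 // -expRN; apply: le_trans L_le _.
  by rewrite expRD [X in X * t]mulrC mulrAC.
rewrite exprMn ler_wpM2r ?(ltW t0) // -expRM_natl ler_expR -natr1; lra.
Qed.

(** Beyond [a] and [A + 2 D], the constant collects [1] from [ln (2 k) <= e ln (k + 2)] and [1 + D]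
    from [2 exp D <= exp ((1 + D) k)]. *)
Lemma moment_constant_le (R : realType) (a x : R) (A D k N : nat) :
  (0 < k)%N -> N%:R <= x ->
  (expR a * ln (2 * k)%:R * expR (A + 2 * D)%:R) ^+ k * (2 * N%:R * expR D%:R) <=
    expR (k%:R * ln (ln (k%:R + 2)) + (a + 2 + (A + 3 * D)%:R) * k%:R) * x.
Proof.
move=> k_gt0 le_Nx; set C := a + 2 + _.
have k1 : 1 <= k%:R :> R by rewrite ler1n.
have e2 : 2 <= expR (1 : R) by have := expR_ge1Dx (1 : R); lra.
have lnk : 0 < ln (k%:R + 2 : R) by rewrite ln_gt0; lra.
have ln2k_ge0 : 0 <= ln (2 * k)%:R :> R by rewrite ln_ge0 // ler1n muln_gt0.
(* This rests on [2 k <= (k + 2)^2] and [2 <= e]. *)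
have ln2k : ln (2 * k)%:R <= expR 1 * ln (k%:R + 2 : R).
  apply: (@le_trans _ _ (2 * ln (k%:R + 2))); last by rewrite ler_wpM2r // ltW.
  rewrite mulr_natl -lnXn; last lra.
  have le_sqr : 2 * k%:R <= (k%:R + 2) ^+ 2 :> R by nra.
  have k2_gt0 : 0 < k%:R + 2 :> R by lra.
  by rewrite natrM ler_ln ?posrE ?exprn_gt0 ?mulr_gt0 //; lra.
have factor2 : 2 * expR D%:R <= expR (1 + D%:R) ^+ k :> R.
  apply: (@le_trans _ _ (expR (1 + D%:R))).
    by rewrite expRD ler_wpM2r ?expR_ge0.
  rewrite -expRM_natl ler_expR; have : 0 <= D%:R :> R by []; nra.
rewrite [2 * _ * _]mulrAC mulrA; apply: ler_pM => //.
  by rewrite !mulr_ge0 ?expR_ge0 // exprn_ge0 // !mulr_ge0 ?expR_ge0.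
rewrite [C * _]mulrC -mulrDr expRM_natl expRD lnK ?posrE //.
apply: (le_trans (ler_wpM2l _ factor2)).
  by rewrite exprn_ge0 // !mulr_ge0 ?expR_ge0.
rewrite -exprMn; apply: lerXn2r; rewrite ?nnegrE.
- by rewrite !mulr_ge0 ?expR_ge0.
- by rewrite mulr_ge0 ?expR_ge0 ?ltW.
have -> : C = a + (A + 2 * D)%:R + (1 + D%:R) + 1.
  have -> : C = a + 2 + (A + 2 * D + D)%:R by congr (_ + _%:R); lia.
  by rewrite [(_ + D)%:R]natrD; ring.
rewrite !expRD [leLHS](_ : _ = expR a * expR (A + 2 * D)%:R *
  (expR 1 * expR D%:R) * ln (2 * k)%:R); last by ring.
rewrite [leRHS](_ : _ = expR a * expR (A + 2 * D)%:R *
  (expR 1 * expR D%:R) * (expR 1 * ln (k%:R + 2))); last by ring.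
by rewrite ler_wpM2l // !mulr_ge0 ?expR_ge0.
Qed.

Theorem theorem1p3 (R : realType) (f : {poly int})
    (f_lead : 0 < lead_coef f)
    (f_gcd : zcontents f = 1)
    (f_pos : pos_preserving f) :
  exists C c1 c2 : R,
    [/\ 0 < C, 0 < c1, 0 < c2 &
      forall (x : R) (s : nat) (t : R), 1 <= x -> (0 < s)%N -> 0 < t ->
        \sum_(1 <= n < (Num.truncn x).+1) totient_ratio R f n ^+ s
          <= expR (s%:R * ln (ln (s%:R + 2)) + C * s%:R) * x
        /\
        #|[set n : 'I_(Num.truncn x).+1
            | (0 < n)%N && (t < totient_ratio R f n)]|%:R
          <= c1 * expR (- expR (c2 * t)) * x].
Proof.
pose A := (\sum_(i < size f) absz (f`_i)%R)%N; pose D := (size f).-1.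
(* The part [4 - ln (ln 2)] is the exponent in the Mertens product bound. *)
pose C : R := 4 - ln (ln 2) + 2 + (A + 3 * D)%:R.
have ln2 : 0 < ln (2 : R) by rewrite ln_gt0 ?ltr1n.
have C_gt0 : 0 < C.
  have := ln_sublinear ln2; have := @ln_sublinear R 2 (ltr0n _ 2).
  by have : 0 <= (A + 3 * D)%:R :> R by []; rewrite /C; lra.
exists C, (expR 3), (expR (- C - 1)).
split; rewrite ?expR_gt0 // => x s t x_ge1 s_gt0 t_gt0.
set N := Num.truncn x; have x_ge0 : 0 <= x by apply: le_trans x_ge1.
have N_gt0 : (0 < N)%N by rewrite truncn_gt0.
have le_Nx : N%:R <= x by rewrite truncn_le.
have moment k : (0 < k)%N -> \sum_(1 <= n < N.+1) totient_ratio R f n ^+ k <=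
    expR (k%:R * ln (ln (k%:R + 2)) + C * k%:R) * x.
  move=> k_gt0.
  have natval_gt0 n : (0 < n)%N -> (0 < natval f n)%N.
    by move/f_pos; rewrite absz_gt0 => /lt0r_neq0.
  have natval_le n : (0 < n <= N)%N -> (natval f n <= A * N ^ D)%N.
    by case/andP=> _; exact: natval_leq.
  apply: le_trans (totient_moment_le R natval_gt0 natval_le
    (@dvdn_natval_periodic f) (fun p a P => @count_natval_roots_leq f p a P f_gcd)
    k_gt0 N_gt0) _.
  exact: moment_constant_le.
split; first exact: moment.
apply: (tail_of_moments _ le_Nx t_gt0 moment) => n.
by rewrite divr_ge0.
Qed.
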